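(* Let $\Lambda$ be a totally ordered nontrivial abelian group. Assume that $\alpha,\beta,\gamma,\delta\in\Lambda$ satisfy the following conditions: (1) $\gamma-\alpha-\beta\in 2\Lambda$ and $\delta-\alpha-\beta\in 2\Lambda$; (2) either $\gamma=\delta>\alpha+\beta$ or $\max\{\gamma,\delta\}=\alpha+\beta$; (3) $\alpha>0$, $\beta>0$, and $|\alpha-\beta|<\min\{\gamma,\delta\}$. Then there exists exactly one pseudo-length $\lVert\cdot\rVert\colon F(a,b)\to\Lambda_{+}$ on the free group $F(a,b)$ over $\{a,b\}$ such that $\lVert a\rVert=\alpha$, $\lVert b\rVert=\beta$, $\lVert ab\rVert=\gamma$, and $\lVert ab^{-1}\rVert=\delta$.
   Context: $\Lambda$ is written additively; $\Lambda_{+}:=\{\lambda\in\Lambda:\lambda\ge 0\}$, $|\lambda|:=\max\{\lambda,-\lambda\}$, and $2\Lambda:=\{2\lambda:\lambda\in\Lambda\}$. A function $\lVert\cdot\rVert\colon G\to\Lambda_{+}$ on a group $G$ is a pseudo-length if: (A0) $\max\{0,\lVert gh\rVert-\lVert g\rVert-\lVert h\rVert\}\in 2\Lambda$ for any $g,h\in G$ with $\lVert g\rVert>0$, $\lVert h\rVert>0$; (A1) $\lVert ghg^{-1}\rVert=\lVert h\rVert$ for any $g,h\in G$; (A2) $\lVert gh\rVert=\lVert gh^{-1}\rVert$ or $\max\{\lVert gh\rVert,\lVert gh^{-1}\rVert\}\le\lVert g\rVert+\lVert h\rVert$, for any $g,h\in G$; (A3) $\lVert gh\rVert=\lVert gh^{-1}\rVert>\lVert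 g\rVert+\lVert h\rVert$ or $\max\{\lVert gh\rVert,\lVert gh^{-1}\rVert\}=\lVert g\rVert+\lVert h\rVert$, for any $g,h\in G$ with $\lVert g\rVert>0$, $\lVert h\rVert>0$. *)

(* Defs.v *)
From HB Require Import structures.
From mathcomp Require Import all_boot all_order all_algebra.

Set Implicit Arguments.
Unset Strict Implicit.
Unset Printing Implicit Defensive.

Import Order.TTheory GRing.Theory Num.Theory.

Local Open Scope ring_scope.

(* [Num.POrderedZmodule] is only the join of the two structures: it assumes   *)
(* neither totality nor compatibility of the order with addition.             *)
HB.mixin Record POrderedZmodule_isTotallyOrdered L of Num.POrderedZmodule L := {
  oz_le_total : total (<=%R : rel L);
  oz_leD2l : forall z x y : L, x <= y -> z + x <= z + y
}.

#[short(type="orderedZmodType")]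
HB.structure Definition OrderedZmodule :=
  { L of POrderedZmodule_isTotallyOrdered L & Num.POrderedZmodule L }.

Section OrderedZmoduleDefs.

Variable L : orderedZmodType.

Definition oz_abs (x : L) : L := Num.max x (- x).

Definition in_2L (x : L) : Prop := exists y : L, x = y *+ 2.

Record pseudo_length (G : groupType) (l : G -> L) : Prop := PseudoLength {
  plen_ge0 : forall g, 0 <= l g;
  plen_A0 : forall g h, 0 < l g -> 0 < l h ->
    in_2L (Num.max 0 (l (g * h)%g - l g - l h));
  plen_A1 : forall g h, l (g * h * g^-1)%g = l h;
  plen_A2 : forall g h,
    l (g * h)%g = l (g * h^-1)%g \/
    Num.max (l (g * h)%g) (l (g * h^-1)%g) <= l g + l h;
  plen_A3 : forall g h, 0 < l g -> 0 < l h ->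
    (l (g * h)%g = l (g * h^-1)%g /\ l g + l h < l (g * h)%g) \/
    Num.max (l (g * h)%g) (l (g * h^-1)%g) = l g + l h
}.

End OrderedZmoduleDefs.

Section FreeGroup.

Variable X : choiceType.

(* The letter (x, false) stands for x, and (x, true) for its inverse.         *)
Definition letter_inv (k : X * bool) : X * bool := (k.1, ~~ k.2).

Definition reduced (w : seq (X * bool)) : bool :=
  sorted (fun k l => l != letter_inv k) w.

Record free_group : Type :=
  FreeGroup { word : seq (X * bool); _ : reduced word }.

HB.instance Definition _ := [isSub for word].
HB.instance Definition _ := [Choice of free_group by <:].

(* Left multiplication of a reduced word by a letter.                         *)
Definition cons_letter (k : X * bool) (w : seq (X * bool)) :=
  if w is l :: w' then if l == letter_inv k then w' else k :: w else [:: k].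

Definition word_mul (u v : seq (X * bool)) := foldr cons_letter v u.

Definition word_inv (u : seq (X * bool)) := rev (map letter_inv u).

Lemma letter_invK : involutive letter_inv.
Proof. by case=> x b; rewrite /letter_inv /= negbK. Qed.

Lemma reduced_cons_letter k w : reduced w -> reduced (cons_letter k w).
Proof.
case: w => [|l w] //= rw; case: eqP => [_|/eqP nkl]; first exact: path_sorted rw.
by rewrite /= nkl.
Qed.

Lemma cons_letterK k w :
  reduced w -> cons_letter k (cons_letter (letter_inv k) w) = w.
Proof.
case: w => [|l w] /=; first by rewrite eqxx.
rewrite letter_invK; case: (eqVneq l k) => [->|_] /=; last by rewrite eqxx.
by case: w => [|m w] //= /andP[/negbTE->].
Qed.

Lemma word_mul_reduced u v : reduced v -> reduced (word_mul u v).
Proof. by move=> rv; elim: u => //= k u; apply: reduced_cons_letter. Qed.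

Lemma word_inv_reduced u : reduced u -> reduced (word_inv u).
Proof.
rewrite /reduced /word_inv rev_sorted sorted_map; apply: sub_sorted => k l /=.
by apply: contra => /eqP /(can_inj letter_invK) ->; rewrite letter_invK.
Qed.

Lemma word_mul_cons k u w : reduced w ->
  word_mul (cons_letter k u) w = cons_letter k (word_mul u w).
Proof.
case: u => [|l u] //= rw; case: eqP => [->|_] //=.
by rewrite cons_letterK //; apply: word_mul_reduced.
Qed.

Lemma word_mulA u v w :
  reduced w -> word_mul u (word_mul v w) = word_mul (word_mul u v) w.
Proof. by move=> rw; elim: u => //= k u ->; rewrite word_mul_cons. Qed.

Lemma word_mulw1 u : reduced u -> word_mul u [::] = u.
Proof.
elim: u => //= k u IHu rku; rewrite IHu; last exact: path_sorted rku.
by case: u rku {IHu} => //= l u /andP[/negbTE->].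
Qed.

Lemma word_mulVw u : word_mul (word_inv u) u = [::].
Proof.
elim: u => // k u IHu.
by rewrite /word_inv /word_mul /= rev_cons foldr_rcons /= letter_invK eqxx.
Qed.

Lemma word_invK : involutive word_inv.
Proof.
by move=> u; rewrite /word_inv map_rev revK mapK //; apply: letter_invK.
Qed.

Definition free_one : free_group := @FreeGroup [::] isT.
Definition free_mul (u v : free_group) : free_group :=
  @FreeGroup (word_mul (val u) (val v)) (word_mul_reduced (val u) (valP v)).
Definition free_inv (u : free_group) : free_group :=
  @FreeGroup (word_inv (val u)) (word_inv_reduced (valP u)).

Lemma free_mulA : associative free_mul.
Proof. by move=> u v w; apply/val_inj/word_mulA/valP. Qed.
Lemma free_mul1w : left_id free_one free_mul.
Proof. by move=> u; apply: val_inj. Qed.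
Lemma free_mulw1 : right_id free_one free_mul.
Proof. by move=> u; apply/val_inj/word_mulw1/valP. Qed.
Lemma free_mulVw : left_inverse free_one free_inv free_mul.
Proof. by move=> u; apply/val_inj/word_mulVw. Qed.
Lemma free_mulwV : right_inverse free_one free_inv free_mul.
Proof.
by move=> u; apply: val_inj; rewrite /= -{1}(word_invK (val u)) word_mulVw.
Qed.

HB.instance Definition _ := isGroup.Build free_group
  free_mulA free_mul1w free_mulw1 free_mulVw free_mulwV.

Definition free_gen (x : X) : free_group := @FreeGroup [:: (x, false)] isT.

Section UniversalProperty.

Variables (G : groupType) (f : X -> G).

Definition letter_eval (k : X * bool) : G :=
  if k.2 then ((f k.1)^-1)%g else f k.1.

Definition free_eval (u : free_group) : G :=
  foldr (fun k g => letter_eval k * g)%g 1%g (val u).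

Lemma free_eval_gen x : free_eval (free_gen x) = f x.
Proof. exact: mulg1. Qed.

Lemma free_evalM u v : free_eval (u * v)%g = (free_eval u * free_eval v)%g.
Proof.
case: u v => [u ru] [v rv]; rewrite /free_eval /= {ru rv}.
elim: u => [|k u IHu] /=; first by rewrite mul1g.
rewrite -mulgA -{}IHu; case: (word_mul u v) => //= l w.
case: eqP => //= ->; rewrite mulgA /letter_eval /=.
by case: k.2; rewrite /= ?mulVg ?mulgV mul1g.
Qed.

Lemma free_eval_unique (h : free_group -> G) :
    {morph h : u v / (u * v)%g} -> (forall x, h (free_gen x) = f x) ->
  h =1 free_eval.
Proof.
move=> hM hf.
have h1 : h 1%g = 1%g by apply: (mulgI (h 1%g)); rewrite -hM !mulg1.
have hV x : h (free_gen x)^-1%g = (f x)^-1%g.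
  by apply: (mulgI (f x)); rewrite mulgV -hf -hM mulgV.
case=> u; elim: u => [|k u IHu] ru; first by rewrite -[RHS]h1; congr h; apply: val_inj.
have ru' : reduced u by apply: path_sorted ru.
pose lk : free_group := @FreeGroup [:: k] isT.
have -> : @FreeGroup (k :: u) ru = (lk * @FreeGroup u ru' :> free_group)%g.
  apply: val_inj => /=; case: u ru {IHu ru'} => //= l u /andP[/negbTE->] //.
rewrite hM free_evalM IHu; congr (_ * _)%g.
rewrite /free_eval /= mulg1 /letter_eval /lk; case: k {ru lk} => x [] /=.
  by rewrite -hV; congr h; apply: val_inj.
by rewrite -hf; congr h; apply: val_inj.
Qed.

End UniversalProperty.

End FreeGroup.

Notation F_ab := (free_group bool).
Definition F_a : F_ab := free_gen true.
Definition F_b : F_ab := free_gen false.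

(* Main.v *)
(* Existence: the graph whose fundamental group is F(a,b) and in which a, b, ab
   and ab^-1 have the prescribed lengths consists of two circles which are
   joined by a segment or share one. The lengths of its closed paths are
   obtained by mapping F(a,b) to a free group of rank three and taking the total
   weight of the cyclically reduced form there. Such a weighted cyclic length is
   a pseudo-length: conjugate the pair g, h so that g = c is cyclically reduced
   and h = v d v^-1; after rotating c, either nothing cancels in gh and gh^-1,
   or v is empty and nothing cancels in one of cd and cd^-1.
   Uniqueness: compare a pseudo-length with the one just built, by induction on
   words. If a cyclically reduced word repeats a letter it is (ku)(kv) up to
   rotation, and its length is forced by (A3) because u v^-1 is strictly shorter
   than ku and kv together. Without repetition only a, b, ab, ab^-1 and the
   commutator remain, up to conjugation and inversion. *)
Require Import Defs.
From mathcomp Require Import all_boot all_order all_algebra.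
From mathcomp Require Import zify.
From Stdlib Require Import FunctionalExtensionality.

Set Implicit Arguments.
Unset Strict Implicit.
Unset Printing Implicit Defensive.

Import Order.TTheory GRing.Theory Num.Theory.

Local Open Scope ring_scope.

(** * Arithmetic in totally ordered abelian groups *)

Section OrderedZmoduleTheory.

Variable L : orderedZmodType.
Implicit Types x y z t : L.

Lemma oz_comparable x y : (x >=< y)%O.
Proof. exact: oz_le_total. Qed.

Lemma oz_ltNge x y : (x < y) = ~~ (y <= x).
Proof. exact: comparable_ltNge (oz_comparable x y). Qed.

Lemma oz_leD2lE z x y : (z + x <= z + y) = (x <= y).
Proof.
apply/idP/idP; last exact: oz_leD2l.
by move=> /(oz_leD2l (- z)); rewrite !addKr.
Qed.

Lemma oz_ltD2lE z x y : (z + x < z + y) = (x < y).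
Proof. by rewrite !oz_ltNge oz_leD2lE. Qed.

Lemma oz_leD x y z t : x <= y -> z <= t -> x + z <= y + t.
Proof.
move=> xy zt; apply: (@le_trans _ _ (x + t)); first by rewrite oz_leD2lE.
by rewrite ![_ + t]addrC oz_leD2lE.
Qed.

Lemma oz_ltD x y z t : x < y -> z < t -> x + z < y + t.
Proof.
move=> xy zt; apply: (@lt_trans _ _ (x + t)); first by rewrite oz_ltD2lE.
by rewrite ![_ + t]addrC oz_ltD2lE.
Qed.

Lemma oz_addr_ge0 x y : 0 <= x -> 0 <= y -> 0 <= x + y.
Proof. by move=> x0 y0; rewrite -[0]addr0 oz_leD. Qed.

Lemma oz_ler_wDr x y : 0 <= y -> x <= x + y.
Proof. by rewrite -{1}[x]addr0 oz_leD2lE. Qed.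

Lemma oz_ler_wDl x y : 0 <= y -> x <= y + x.
Proof. by rewrite addrC; apply: oz_ler_wDr. Qed.

Lemma oz_subr_ge0 x y : (0 <= x - y) = (y <= x).
Proof. by rewrite -[LHS](oz_leD2lE y) addr0 addrC subrK. Qed.

Lemma oz_subr_gt0 x y : (0 < x - y) = (y < x).
Proof. by rewrite -[LHS](oz_ltD2lE y) addr0 addrC subrK. Qed.

Lemma oz_oppr_ge0 x : (0 <= - x) = (x <= 0).
Proof. by rewrite -oz_subr_ge0 sub0r. Qed.

Lemma oz_mul2n_gt0 x : (0 < x *+ 2) = (0 < x).
Proof.
rewrite mulr2n; apply/idP/idP => [|x0]; last first.
  by rewrite -[0]addr0; apply: oz_ltD.
by rewrite !oz_ltNge; apply: contra => x0; rewrite -[0]addr0; apply: oz_leD.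
Qed.

Lemma oz_mul2n_ge0 x : (0 <= x *+ 2) = (0 <= x).
Proof.
rewrite mulr2n; apply/idP/idP => [|x0]; last first.
  by rewrite -[0]addr0; apply: oz_leD.
apply: contraTT; rewrite -!oz_ltNge => x0; rewrite -[0]addr0; exact: oz_ltD.
Qed.

(** Two bounds together with attainment: this is the form in which the maxima of (A0) and (A3) are
    taken apart and, by [oz_eq_max], put together. *)
Lemma oz_max_eq x y z :
  Num.max x y = z -> [/\ x <= z, y <= z & x = z \/ y = z].
Proof.
by case: (comparable_ltgtP (oz_comparable x y)) => [xy|yx|->] <-;
  split; rewrite ?lexx //; [exact: ltW|right|exact: ltW|left|left].
Qed.

Lemma oz_eq_max x y z :
  x <= z -> y <= z -> x = z \/ y = z -> Num.max x y = z.
Proof.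
case: (comparable_ltgtP (oz_comparable x y)) => [xy|yx|->] xz yz [] // e.
- by apply: le_anti; rewrite yz -e ltW.
- by apply: le_anti; rewrite xz -e ltW.
Qed.

End OrderedZmoduleTheory.

(** * Consequences of the pseudo-length axioms *)

Section PseudoLengthTheory.

Variables (L : orderedZmodType) (G : groupType) (l : G -> L).
Hypothesis lP : pseudo_length l.
Implicit Types g h : G.

(** If [l 1] were positive, (A3) at [g = h = 1] would make [l 1 + l 1] either less than or equal to
    [l 1]. *)
Lemma plen1 : l 1%g = 0.
Proof.
have := plen_ge0 lP 1%g; rewrite le_eqVlt => /orP[/eqP //|l1].
have := plen_A3 lP l1 l1; rewrite invg1 mulg1 => -[[_]|].
  by rewrite -[X in _ < X]addr0 oz_ltD2lE oz_ltNge ltW.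
by rewrite maxxx -{1}(addr0 (l 1%g)) => /addrI.
Qed.

Lemma plenV g : l g^-1%g = l g.
Proof.
have le h : l h^-1%g <= l h.
  have := plen_A2 lP 1%g h; rewrite !mul1g plen1 add0r => -[-> //|].
  by rewrite (comparable_ge_max _ (oz_comparable _ _)) => /andP[].
by apply: le_anti; rewrite le /= -{1}(invgK g) le.
Qed.

Lemma plenC g h : l (g * h)%g = l (h * g)%g.
Proof. by rewrite -(plen_A1 lP h (g * h)%g) mulgA mulgK. Qed.

(** The first alternative of (A3) would put the quotient above the sum, and in the second the
    maximum cannot be attained at the quotient. *)
Lemma plen_sum g h : 0 < l g -> 0 < l h ->
  l (g * h^-1)%g < l g + l h -> l (g * h)%g = l g + l h.
Proof.
move=> lg lh lt; case: (plen_A3 lP lg lh) => [[e]|/oz_max_eq[_ _ []] // e].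
  by rewrite e oz_ltNge ltW.
by rewrite e ltxx in lt.
Qed.

Lemma plen_eq g h : 0 < l g -> 0 < l h ->
  l g + l h < l (g * h^-1)%g -> l (g * h)%g = l (g * h^-1)%g.
Proof.
move=> lg lh lt; case: (plen_A3 lP lg lh) => [[//]|/oz_max_eq[_]].
by rewrite oz_ltNge in lt; rewrite (negPf lt).
Qed.

Lemma plen_sqr g : 0 < l g -> l (g * g)%g = l g *+ 2.
Proof.
move=> lg; rewrite mulr2n; apply: plen_sum => //.
by rewrite mulgV plen1 -[0]addr0 oz_ltD.
Qed.

End PseudoLengthTheory.

Lemma pseudo_length_comp (L : orderedZmodType) (G H : groupType) (l : H -> L)
    (f : G -> H) : {morph f : g h / (g * h)%g} -> pseudo_length l ->
  pseudo_length (l \o f).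
Proof.
move=> fM lP.
have f1 : f 1%g = 1%g by apply: (mulgI (f 1%g)); rewrite -fM !mulg1.
have fV g : f g^-1%g = (f g)^-1%g by apply: (mulgI (f g)); rewrite -fM !mulgV.
split=> [g|g h|g h|g h|g h] /=; rewrite ?fM ?fV.
- exact: plen_ge0 lP _.
- exact: plen_A0 lP _ _.
- exact: plen_A1 lP _ _.
- exact: plen_A2 lP _ _.
- exact: plen_A3 lP _ _.
Qed.

(** * Reduced and cyclically reduced words *)

Section Words.

Variable X : choiceType.
Implicit Types (k : X * bool) (u v w c d : seq (X * bool)).
Implicit Types (g h z : free_group X).

Definition of_letter k : free_group X := @FreeGroup X [:: k] isT.

Definition of_word w : free_group X :=
  foldr (fun k g => (of_letter k * g)%g) 1%g w.

Lemma of_word_cat u v : of_word (u ++ v) = (of_word u * of_word v)%g.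
Proof. by elim: u => [|k u /= ->]; rewrite ?mul1g ?mulgA. Qed.

Lemma of_word1 k : of_word [:: k] = of_letter k.
Proof. exact: mulg1. Qed.

Lemma of_letterV k : of_letter (letter_inv k) = (of_letter k)^-1%g.
Proof. exact: val_inj. Qed.

Lemma word_inv_cons k u : word_inv (k :: u) = rcons (word_inv u) (letter_inv k).
Proof. exact: rev_cons. Qed.

Lemma word_inv_cat u v : word_inv (u ++ v) = word_inv v ++ word_inv u.
Proof. by rewrite /word_inv map_cat rev_cat. Qed.

Lemma size_word_inv u : size (word_inv u) = size u.
Proof. by rewrite size_rev size_map. Qed.

Lemma of_wordV u : of_word (word_inv u) = (of_word u)^-1%g.
Proof.
elim: u => [|k u IHu]; first by rewrite invg1.
by rewrite word_inv_cons -cats1 of_word_cat IHu /= mulg1 of_letterV invgM.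
Qed.

Lemma val_of_word w : reduced w -> val (of_word w) = w.
Proof.
elim: w => [|k w IHw] //= rw; rewrite IHw; last exact: path_sorted rw.
by case: w rw {IHw} => //= l w /andP[/negbTE ->].
Qed.

Lemma of_wordK g : of_word (val g) = g.
Proof. by apply/val_inj/val_of_word/valP. Qed.

Lemma letter_inv_neq k : k != letter_inv k.
Proof. by apply/eqP => /(congr1 snd) /=; case: k.2. Qed.

Lemma eq_letter_inv k l : (k == letter_inv l) = (l == letter_inv k).
Proof. by rewrite -(can_eq (@letter_invK X)) letter_invK eq_sym. Qed.

Definition cyc_reduced w := cycle (fun k l => l != letter_inv k) w.

Lemma cyc_reducedV w : cyc_reduced (word_inv w) = cyc_reduced w.
Proof.
rewrite /cyc_reduced /word_inv rev_cycle cycle_map.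
by apply: eq_cycle => k l /=; rewrite letter_invK eq_sym -eq_letter_inv.
Qed.

Lemma cyc_reduced_cons k w :
  cyc_reduced (k :: w) = reduced (k :: w) && (k != letter_inv (last k w)).
Proof. exact: rcons_path. Qed.

Lemma cyc_reducedW w : cyc_reduced w -> reduced w.
Proof. by case: w => // k w; rewrite cyc_reduced_cons => /andP[]. Qed.

Lemma reduced_catl u v : reduced (u ++ v) -> reduced u.
Proof. by case: u => //= k u; rewrite cat_path => /andP[]. Qed.

(** The word obtained is the reduced form of the square of [u c u^-1]. *)
Lemma reduced_sandwich u c : reduced (u ++ c ++ word_inv u) -> c != [::] ->
  cyc_reduced c -> reduced (u ++ c ++ c ++ word_inv u).
Proof.
case: c => // k c; rewrite /reduced /= !sorted_cat_cons !cat_path.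
case/and3P=> -> -> /= pl _.
by rewrite /cyc_reduced /= rcons_path cat_path => /andP[-> ->].
Qed.

Lemma conj_nil u : reduced (u ++ word_inv u) -> u = [::].
Proof.
case/lastP: u => // u k.
rewrite /reduced cat_rcons /word_inv map_rcons rev_rcons.
by rewrite sorted_cat_cons /= eqxx andbF.
Qed.

Lemma cyc_reduced_cat k c l d : cyc_reduced ((k :: c) ++ l :: d) =
  [&& reduced (k :: c), reduced (l :: d), l != letter_inv (last k c)
    & k != letter_inv (last l d)].
Proof.
rewrite cat_cons cyc_reduced_cons /reduced /= cat_path last_cat /=.
by case: (path _ k c) => //=; case: (path _ l d); rewrite /= ?andbT ?andbF.
Qed.

Lemma cyc_reduced_letter2 k l : l.1 != k.1 -> cyc_reduced [:: k; l].
Proof.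
move=> kl; rewrite /cyc_reduced /= andbT; apply/andP; split.
  by apply: contra kl => /eqP ->.
by apply: contra kl => /eqP ->.
Qed.

Lemma word_invE k w :
  exists2 w', word_inv (k :: w) = letter_inv (last k w) :: w'
  & last (letter_inv (last k w)) w' = letter_inv k.
Proof.
have e : word_inv (k :: w) = letter_inv (last k w) :: word_inv (belast k w).
  by rewrite lastI /word_inv map_rcons rev_rcons.
exists (word_inv (belast k w)) => //.
by rewrite -(last_cons k) -e word_inv_cons last_rcons.
Qed.

Lemma not_reduced w : ~~ reduced w ->
  exists u k v, w = u ++ [:: k, letter_inv k & v].
Proof.
elim: w => [|k [|l w] IHw] //=; rewrite negb_and => /orP[/negPn/eqP ->|/IHw].
  by exists [::], k, w.
by case=> u [m [v ->]]; exists (k :: u), m, v.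
Qed.

End Words.

(** * The weighted cyclic length is a pseudo-length *)

Section WeightedLength.

Variables (X : choiceType) (L : orderedZmodType) (wt : X -> L).
Hypothesis wt_ge0 : forall x, 0 <= wt x.
Implicit Types (k : X * bool) (u v w c d : seq (X * bool)).
Implicit Types (g h z : free_group X).

Definition wlen w : L := \sum_(k <- w) wt k.1.

Lemma wlen_cons k w : wlen (k :: w) = wt k.1 + wlen w.
Proof. exact: big_cons. Qed.

Lemma wlen_cat u v : wlen (u ++ v) = wlen u + wlen v.
Proof. exact: big_cat. Qed.

Lemma wlen_rcons w k : wlen (rcons w k) = wt k.1 + wlen w.
Proof. by rewrite -cats1 wlen_cat wlen_cons /wlen big_nil addr0 addrC. Qed.

Lemma wlenV w : wlen (word_inv w) = wlen w.
Proof.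
elim: w => [|k w IHw]; first by [].
by rewrite word_inv_cons wlen_rcons wlen_cons IHw.
Qed.

Lemma wlen_ge0 w : 0 <= wlen w.
Proof.
rewrite /wlen; elim: w => [|k w IHw]; first by rewrite big_nil.
by rewrite big_cons oz_addr_ge0.
Qed.

Lemma wlen_of_word w : wlen (val (of_word w)) <= wlen w.
Proof.
elim: w => [|k w IHw] //; rewrite wlen_cons.
apply: (@le_trans _ _ (wt k.1 + wlen (val (of_word w)))); last exact: oz_leD2l.
rewrite (_ : val (of_word (k :: w)) = cons_letter k (val (of_word w))) //.
case: (val (of_word w)) => [|l v] /=; first by rewrite wlen_cons.
case: ifP => _; rewrite ?wlen_cons //.
by rewrite addrA oz_ler_wDl // oz_addr_ge0.
Qed.

(** For [g = u c u^-1] with [c] cyclically reduced the square is [u c c u^-1], so the difference is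
    the weight of [c]; no conjugating word has to be chosen. *)
Definition cyc_len g : L := wlen (val (g * g)%g) - wlen (val g).

Lemma cyc_len_reduced u c : reduced (u ++ c ++ word_inv u) -> cyc_reduced c ->
  cyc_len (of_word (u ++ c ++ word_inv u)) = wlen c.
Proof.
move=> red rc; rewrite /cyc_len.
have [c0|c0] := eqVneq c [::].
  by move: red; rewrite c0 => /conj_nil -> /=; rewrite subrr /wlen big_nil.
rewrite (_ : _ * _ = of_word (u ++ c ++ c ++ word_inv u))%g; last first.
  by rewrite !of_word_cat of_wordV !mulgA mulgVK.
rewrite !val_of_word ?reduced_sandwich // !wlen_cat.
by rewrite addrCA addrK.
Qed.

(** Induction on the letters of [z]. Conjugation by one letter shortens [u], lengthens it, or, when
    [u] is empty and the letter cancels against an end of [d], rotates [d]; the weight of [d] is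
    preserved throughout. *)
Lemma cyc_reduced_conj z c : cyc_reduced c -> exists u d,
  [/\ (z * of_word c * z^-1)%g = of_word (u ++ d ++ word_inv u),
      reduced (u ++ d ++ word_inv u), cyc_reduced d & wlen d = wlen c].
Proof.
move=> rc; rewrite -(of_wordK z); elim: (val z) => [|k w].
  exists [::], c; split; rewrite ?mul1g ?invg1 ?mulg1 ?cats0 //=.
  exact: cyc_reducedW.
case=> u [d [e red rd <-]].
have {e}-> : (of_word (k :: w) * of_word c * (of_word (k :: w))^-1 =
    of_letter k * of_word (u ++ d ++ word_inv u) * (of_letter k)^-1)%g.
  by rewrite -e /= invgM !mulgA.
have conjE v : (of_letter k * of_word v * (of_letter k)^-1)%g =
    of_word (k :: rcons v (letter_inv k)).
  by rewrite /= -cats1 of_word_cat of_word1 of_letterV mulgA.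
case: u red => [|l u] red.
  rewrite !cats0 in red *; case: d rd red => [|l d] rd red.
    by exists [::], [::]; split=> //=; rewrite mulg1 mulgV.
  have [e|lk] := eqVneq l (letter_inv k).
    exists [::], (rcons d l); rewrite cats0 e -/(cyc_reduced _); split.
    - by rewrite /= of_letterV mulVKg -cats1 of_word_cat of_word1 of_letterV.
    - by apply: cyc_reducedW; rewrite /cyc_reduced -rot1_cons rot_cycle -e.
    - by rewrite /cyc_reduced -rot1_cons rot_cycle -e.
    - by rewrite wlen_rcons wlen_cons.
  have [e|kl] := eqVneq (last l d) k.
    exists [::], (k :: belast l d); rewrite cats0.
    have rot_eq : l :: d = rot 1 (k :: belast l d).
      by rewrite rot1_cons lastI e.
    have rd' : cyc_reduced (k :: belast l d).
      by move: rd; rewrite rot_eq /cyc_reduced rot_cycle.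
    split=> //; last by rewrite (lastI l) e wlen_rcons wlen_cons.
      by rewrite (lastI l) e /= -cats1 of_word_cat of_word1 !mulgA mulgK.
    exact: cyc_reducedW.
  exists [:: k], (l :: d); split=> //; first by rewrite conjE -cats1.
  rewrite /= lk; rewrite /reduced /= in red.
  by rewrite cats1 rcons_path red (can_eq (@letter_invK X)) eq_sym.
have [e|lk] := eqVneq l (letter_inv k).
  exists u, d; split=> //.
    rewrite word_inv_cons /= !of_word_cat -cats1 !of_word_cat e letter_invK.
    by rewrite !of_word1 of_letterV /= !mulgA mulgV mul1g mulgK.
  move: red; rewrite /= word_inv_cons -!rcons_cat => /path_sorted.
  by rewrite -cats1 => /reduced_catl.
exists [:: k, l & u], d; split=> //.
  by rewrite conjE (word_inv_cons k) -!rcons_cat.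
rewrite (word_inv_cons k) -!rcons_cat /= lk /=.
move: red; rewrite /reduced /= => red; rewrite rcons_path red /=.
rewrite word_inv_cons -!rcons_cat last_rcons.
by rewrite (can_eq (@letter_invK X)) eq_letter_inv.
Qed.

Lemma cyc_len_conj z c : cyc_reduced c ->
  cyc_len (z * of_word c * z^-1)%g = wlen c.
Proof.
by case/(cyc_reduced_conj z) => u [d [-> red rd <-]]; apply: cyc_len_reduced.
Qed.

Lemma cyc_len_of_word c : cyc_reduced c -> cyc_len (of_word c) = wlen c.
Proof. by move/(cyc_len_conj 1%g); rewrite mul1g invg1 mulg1. Qed.

(** As long as the first and last letters of the reduced word are inverse to each other, both are
    moved into the conjugating part. *)
Lemma cyc_decomposition g : exists u c,
  [/\ g = of_word (u ++ c ++ word_inv u), reduced (u ++ c ++ word_inv u)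
    & cyc_reduced c].
Proof.
rewrite -[g]of_wordK; move: (val g) (valP g) => w.
have [n] := ubnP (size w); elim: n w => // n IHn [|k w] /=.
  by exists [::], [::].
rewrite ltnS => lew rw; have [rc|nc] := boolP (cyc_reduced (k :: w)).
  by exists [::], (k :: w); rewrite cats0.
move: nc lew rw; rewrite cyc_reduced_cons => /nandP[/negPf nr|].
  by move=> _; rewrite /reduced /= in nr *; rewrite nr.
rewrite negbK; case/lastP: w => [|w l].
  by rewrite (negPf (letter_inv_neq k)).
rewrite last_rcons eq_letter_inv size_rcons => /eqP -> lew rw.
have rw' : reduced w.
  by move: rw => /path_sorted; rewrite -cats1 => /reduced_catl.
have [u [c [e red rc]]] := IHn w (ltnW lew) rw'.
exists (k :: u), c; rewrite word_inv_cons -!rcons_cat; split=> //.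
  by rewrite /= -!cats1 (of_word_cat w) e -of_word_cat.
by rewrite /= -(val_of_word red) -e val_of_word.
Qed.

Lemma cyc_lenJ z g : cyc_len (z * g * z^-1)%g = cyc_len g.
Proof.
have [u [c [-> red rc]]] := cyc_decomposition g.
rewrite cyc_len_reduced // !of_word_cat of_wordV mulgA.
by rewrite -(cyc_len_conj (z * of_word u)%g rc) invgM !mulgA.
Qed.

(** The reduced form is no heavier than [w], and its cyclically reduced core is a part of it. *)
Lemma cyc_len_le w : cyc_len (of_word w) <= wlen w.
Proof.
apply: le_trans (wlen_of_word w).
have [u [c [-> red rc]]] := cyc_decomposition (of_word w).
rewrite cyc_len_reduced // val_of_word // !wlen_cat addrCA.
by apply: oz_ler_wDr; rewrite oz_addr_ge0 // wlen_ge0.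
Qed.

Lemma cyc_len_ge0 g : 0 <= cyc_len g.
Proof.
have [u [c [-> red rc]]] := cyc_decomposition g.
by rewrite cyc_len_reduced // wlen_ge0.
Qed.

(** A common source of (A0), (A2) and (A3): [e] is half the excess, which gives the divisibility in
    (A0). It is invariant under simultaneous conjugation of [g] and [h]. *)
Definition length_alternative g h : Prop :=
  (exists2 e, 0 <= e &
    cyc_len (g * h)%g = cyc_len g + cyc_len h + e *+ 2 /\
    cyc_len (g * h^-1)%g = cyc_len g + cyc_len h + e *+ 2) \/
  Num.max (cyc_len (g * h)%g) (cyc_len (g * h^-1)%g) = cyc_len g + cyc_len h.

Lemma length_alternativeJ z g h :
  length_alternative (z * g * z^-1)%g (z * h * z^-1)%g ->
  length_alternative g h.
Proof.
have eM a b : (z * a * z^-1 * (z * b * z^-1))%g = (z * (a * b) * z^-1)%g.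
  by rewrite !mulgA mulgVK.
have eV a : ((z * a * z^-1)^-1)%g = (z * a^-1 * z^-1)%g.
  by rewrite !invgM invgK mulgA.
by rewrite /length_alternative eV !eM !cyc_lenJ.
Qed.

(* If neither cd nor cd^-1 were cyclically reduced as written, then two of the
   four possible cancellations would contradict the reducedness of c or d. *)
Lemma length_alternative_cyc c d : c != [::] -> d != [::] ->
  cyc_reduced c -> cyc_reduced d ->
  length_alternative (of_word c) (of_word d).
Proof.
move=> c0 d0 rc rd; right; rewrite -of_wordV -!of_word_cat.
rewrite (cyc_len_of_word rc) (cyc_len_of_word rd).
have le1 := cyc_len_le (c ++ d); have le2 := cyc_len_le (c ++ word_inv d).
rewrite !wlen_cat wlenV in le1 le2; apply: oz_eq_max => //.
suff /orP[cd|cd] : cyc_reduced (c ++ d) || cyc_reduced (c ++ word_inv d).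
- by left; rewrite cyc_len_of_word // wlen_cat.
- by right; rewrite cyc_len_of_word // wlen_cat wlenV.
have := rd; rewrite -cyc_reducedV; case: c c0 rc d d0 rd {le1 le2} => // k c _.
rewrite cyc_reduced_cons => /andP[rc kc] [|l d] // _.
have [d' e e'] := word_invE l d.
rewrite e !cyc_reduced_cat !cyc_reduced_cons e'.
move=> /andP[-> ld] /andP[-> _].
rewrite rc !letter_invK (can_eq (@letter_invK X)).
have [lc|_] /= := eqVneq l (letter_inv (last k c)).
  by rewrite {2}lc kc andbT; apply: contraNneq ld => ->; rewrite lc.
have [kd|//] := eqVneq k (letter_inv (last l d)).
rewrite {2}kd [_ == l]eq_sym ld andbT.
by apply: contraNneq kc => <-; rewrite kd.
Qed.

(** Induction on [v]. If [c] starts with the first letter [k] of the conjugating word or ends with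
    its inverse, conjugating both elements by [k^-1] rotates [c] and removes [k]. *)
Lemma length_alternative_conj c v d : c != [::] -> d != [::] ->
  cyc_reduced c -> cyc_reduced d -> reduced (v ++ d ++ word_inv v) ->
  length_alternative (of_word c) (of_word (v ++ d ++ word_inv v)).
Proof.
move=> c0 d0 rc rd; elim: v c c0 rc => [|k v IHv] c c0 rc red.
  by rewrite cats0; apply: length_alternative_cyc.
have red' : reduced (v ++ d ++ word_inv v).
  move: red; rewrite word_inv_cons -!rcons_cat /= => /path_sorted.
  by rewrite -cats1 => /reduced_catl.
have conjE : of_word ((k :: v) ++ d ++ word_inv (k :: v)) =
    (of_letter k * of_word (v ++ d ++ word_inv v) * (of_letter k)^-1)%g.
  rewrite word_inv_cons. rewrite -!rcons_cat /= -cats1 of_word_cat of_word1.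
  by rewrite of_letterV mulgA.
case: c c0 rc => // l c _ rc; have [lk|lk] := eqVneq l k.
  apply: (@length_alternativeJ (of_letter k)^-1%g).
  rewrite conjE invgK lk -(mulgA _ _ (of_letter k)) /= -!mulgA mulKg.
  rewrite mulVg mulg1 mulKg -of_word1 -of_word_cat cats1.
  apply: IHv => //; first by case: (c).
  by rewrite /cyc_reduced -rot1_cons rot_cycle -lk.
have [e|kl] := eqVneq (last l c) (letter_inv k).
  apply: (@length_alternativeJ (of_letter k)^-1%g).
  rewrite conjE invgK (lastI l c) e -cats1 of_word_cat of_word1 of_letterV.
  rewrite -!mulgA mulKg mulVg !mulg1 -of_letterV.
  apply: (IHv (letter_inv k :: belast l c)) => //.
  move: rc; rewrite [l :: c]lastI e -rot1_cons /cyc_reduced.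
  by rewrite rot_cycle.
(* Now nothing cancels between [c] and the conjugate of [d] or of its inverse, even cyclically, so
   the excess is twice the weight of [k :: v]. *)
left; exists (wlen v + wt k.1); first by rewrite oz_addr_ge0 ?wlen_ge0.
have key d1 : cyc_reduced d1 -> reduced ((k :: v) ++ d1 ++ word_inv (k :: v)) ->
    cyc_len (of_word (l :: c) * of_word ((k :: v) ++ d1 ++ word_inv (k :: v)))%g
    = wlen (l :: c) + wlen d1 + (wlen v + wt k.1) *+ 2.
  move=> rd1 red1; rewrite -of_word_cat cyc_len_of_word.
    rewrite !wlen_cat wlenV (wlen_cons k) [wlen v + _]addrC mulr2n.
    by rewrite -[RHS]addrA; congr (_ + _); rewrite addrCA.
  rewrite cat_cons cyc_reduced_cat -cat_cons red1 !last_cat word_inv_cons.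
  rewrite last_rcons letter_invK lk andbT cyc_reducedW //=.
  by rewrite eq_letter_inv in kl.
rewrite cyc_len_reduced // cyc_len_of_word // key //; split=> //.
have redV : reduced ((k :: v) ++ word_inv d ++ word_inv (k :: v)).
  move: red => /word_inv_reduced.
  by rewrite !word_inv_cat word_invK -catA.
rewrite -of_wordV !word_inv_cat word_invK -catA key ?wlenV //.
by rewrite cyc_reducedV.
Qed.

Lemma cyc_len_alternative g h : g != 1%g -> h != 1%g -> length_alternative g h.
Proof.
move=> g1 h1.
have [u [c [eg redu rc]]] := cyc_decomposition g.
have c0 : c != [::].
  apply: contraNneq g1 => c0; rewrite eg c0.
  by rewrite c0 in redu; rewrite (conj_nil redu).
(* This conjugation turns [g] into its core [c]; the conjugate of [h] is decomposed only
   afterwards. *)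
apply: (@length_alternativeJ (of_word u)^-1%g).
have [v [d [eh redv rd]]] :=
  cyc_decomposition ((of_word u)^-1 * h * of_word u)%g.
have d0 : d != [::].
  apply: contraNneq h1 => d0; rewrite d0 in redv eh.
  move: eh; rewrite (conj_nil redv) /=.
  move/(congr1 (fun x => of_word u * x * (of_word u)^-1)%g).
  by rewrite !mulgA mulgV mul1g mulgK mulg1 mulgV => ->.
have -> : ((of_word u)^-1 * g * ((of_word u)^-1)^-1)%g = of_word c.
  by rewrite eg invgK !of_word_cat of_wordV -!mulgA mulVg mulg1 mulKg.
rewrite invgK eh; exact: length_alternative_conj.
Qed.

Lemma cyc_len1 : cyc_len 1%g = 0.
Proof. by rewrite /cyc_len mulg1 subrr. Qed.

Lemma cyc_lenV g : cyc_len g^-1%g = cyc_len g.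
Proof.
have [u [c [-> red rc]]] := cyc_decomposition g.
have := word_inv_reduced red; rewrite -of_wordV !word_inv_cat word_invK -catA.
by move=> red'; rewrite !cyc_len_reduced ?wlenV // cyc_reducedV.
Qed.

Lemma pseudo_length_cyc_len : pseudo_length cyc_len.
Proof.
have gt0_neq1 g : 0 < cyc_len g -> g != 1%g.
  by apply: contraTneq => ->; rewrite cyc_len1 ltxx.
have ge_max (x y z : L) : (Num.max x y <= z) = (x <= z) && (y <= z).
  exact: comparable_ge_max (oz_comparable x y).
split.
- exact: cyc_len_ge0.
- move=> g h /gt0_neq1 g1 /gt0_neq1 h1.
  case: (cyc_len_alternative g1 h1) => [[e e0 [-> _]]|/oz_max_eq[le _ _]].
    exists e; rewrite -[_ - _ - _]addrA -opprD [_ + e *+ 2]addrC addrK.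
    by apply: oz_eq_max; rewrite ?oz_mul2n_ge0 ?lexx //; right.
  exists 0; rewrite mul0rn; apply: oz_eq_max; [| |by left].
    exact: lexx.
  by rewrite -addrA -opprD -oz_oppr_ge0 opprB oz_subr_ge0.
- by move=> g h; rewrite cyc_lenJ.
- move=> g h; have [->|g1] := eqVneq g 1%g.
    by left; rewrite !mul1g cyc_lenV.
  have [->|h1] := eqVneq h 1%g; first by left; rewrite invg1.
  case: (cyc_len_alternative g1 h1) => [[e e0 [-> ->]]|->]; first by left.
  by right; apply: lexx.
- move=> g h /gt0_neq1 g1 /gt0_neq1 h1.
  case: (cyc_len_alternative g1 h1) => [[e]|]; last by right.
  (* Zero excess belongs to the maximum alternative of (A3), since the other one is strict. *)
  rewrite le_eqVlt => /orP[/eqP <- [-> ->]|e0 [-> ->]].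
    by right; rewrite mul0rn addr0 maxxx.
  by left; split=> //; rewrite -[X in X < _]addr0 oz_ltD2lE oz_mul2n_gt0.
Qed.

End WeightedLength.

(** * Lengths of closed paths in a graph of circles *)

Section TwistedLength.

Variables (X : choiceType) (L : orderedZmodType).
Variables (wt : option X -> L) (far : X * bool -> bool).
Hypothesis wt_ge0 : forall x, 0 <= wt x.
Implicit Types (k l c : X * bool) (u v w : seq (X * bool)).

Definition edge k : option X * bool := (Some k.1, k.2).

(** The path from the base vertex to the start of [k]. [far k] tells whether that start is the far
    end of [None]; the end of [k] is the start of [letter_inv k]. *)
Definition approach k : seq (option X * bool) :=
  if far k then [:: (None, false)] else [::].

(* A graph of circles, one for each generator, some of whose ends are attached
   to the far end of one additional edge [None]: the letter [k] is sent to the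
   loop which runs to the start of its own circle, around it, and back. *)
Definition twist : free_group X -> free_group (option X) :=
  free_eval (fun x => of_word (approach (x, false) ++
    (Some x, false) :: word_inv (approach (x, true)))).

Lemma twistM : {morph twist : g h / (g * h)%g}.
Proof. exact: free_evalM. Qed.

Lemma twist_letter k : twist (of_letter k) =
  (of_word (approach k) * of_letter (edge k) *
   (of_word (approach (letter_inv k)))^-1)%g.
Proof.
rewrite /twist /free_eval /= mulg1 /letter_eval; case: k => x [] /=.
  rewrite of_word_cat /= of_wordV !invgM invgK.
  by rewrite -of_letterV.
by rewrite of_word_cat /= of_wordV mulgA.
Qed.

(** The path from the end of [k] to the start of [c]. If it crosses [None], it does so backwards
    exactly when it sets out from the far end. *)
Definition turn k c : seq (option X * bool) :=
  if far (letter_inv k) == far c then [::] else [:: (None, far (letter_inv k))].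

Lemma of_word_turn k c : of_word (turn k c) =
  ((of_word (approach (letter_inv k)))^-1 * of_word (approach c))%g.
Proof.
rewrite /turn /approach; case: (far (letter_inv k)); case: (far c) => /=.
- by rewrite mulVg.
- by rewrite !mulg1 -of_letterV.
- by rewrite !mulg1 invg1 mul1g.
- by rewrite invg1 mulg1.
Qed.

Fixpoint circuit k w c : seq (option X * bool) :=
  if w is l :: w' then turn k l ++ edge l :: circuit l w' c else turn k c.

(** The approaches of consecutive letters telescope into turns; with [c = k] the remaining outer
    factors form a conjugation. *)
Lemma twist_circuit k w c : (twist (of_word (k :: w)) =
  of_word (approach k) * of_word (edge k :: circuit k w c) *
  (of_word (approach c))^-1)%g.
Proof.
elim: w k => [|l w IHw] k.
  by rewrite of_word1 twist_letter /= of_word_turn !mulgA mulgK.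
rewrite [of_word (k :: _)]/= twistM IHw twist_letter /=.
by rewrite of_word_cat of_word_turn /= !mulgA.
Qed.

(** A nonempty turn separates two generator edges by [None]; across an empty one the edges inherit
    the absence of cancellation from the letters. For [c = k] the circuit is thus cyclically
    reduced. *)
Lemma reduced_circuit k w c :
  path (fun i j => j != letter_inv i) k (rcons w c) ->
  path (fun i j => j != letter_inv i) (edge k) (rcons (circuit k w c) (edge c)).
Proof.
have turnP m l p : l != letter_inv m ->
    path (fun i j => j != letter_inv i) (edge l) p ->
    path (fun i j => j != letter_inv i) (edge m) (turn m l ++ edge l :: p).
  rewrite /turn => lm pl; case: ifP => _ /=; last by rewrite pl.
  rewrite pl andbT; apply: contra lm => /eqP[e1 e2].
  by apply/eqP; case: (l) e1 e2 => x y /= -> ->.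
elim: w k => [|l w IHw] k /= /andP[kl pl].
  by rewrite -cats1; apply: turnP.
by rewrite rcons_cat rcons_cons; apply: turnP (IHw _ pl).
Qed.

Definition twisted_len : free_group X -> L := cyc_len wt \o twist.

Lemma pseudo_length_twisted : pseudo_length twisted_len.
Proof.
by apply: pseudo_length_comp twistM _; apply: pseudo_length_cyc_len.
Qed.

Lemma twisted_len_circuit k w : cyc_reduced (k :: w) ->
  twisted_len (of_word (k :: w)) = wlen wt (edge k :: circuit k w k).
Proof.
by move=> rw; rewrite /twisted_len /comp (twist_circuit k w k) cyc_len_conj //;
  apply: reduced_circuit.
Qed.

Lemma wlen_turn k c :
  wlen wt (turn k c) = wt None *+ (far (letter_inv k) != far c).
Proof.
rewrite /turn; case: eqP => _; first by rewrite /wlen big_nil.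
by rewrite wlen_cons /wlen big_nil addr0.
Qed.

Lemma twisted_len_letter k : twisted_len (of_letter k) =
  wt (Some k.1) + wt None *+ (far (letter_inv k) != far k).
Proof.
rewrite -of_word1 twisted_len_circuit ?wlen_cons ?wlen_turn //.
by rewrite /cyc_reduced /= letter_inv_neq.
Qed.

Lemma twisted_len_letter2 k l : l.1 != k.1 ->
  twisted_len (of_letter k * of_letter l)%g = wt (Some k.1) + wt (Some l.1) +
    wt None *+ ((far (letter_inv k) != far l) + (far (letter_inv l) != far k)).
Proof.
move=> kl; have -> : (of_letter k * of_letter l)%g = of_word [:: k; l].
  by rewrite /= mulg1.
rewrite twisted_len_circuit ?cyc_reduced_letter2 //=.
rewrite wlen_cons wlen_cat wlen_cons !wlen_turn mulrnDr -!addrA.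
by congr (_ + _); rewrite addrCA.
Qed.

Lemma twisted_len_gt0 k w : 0 < wt (Some k.1) -> cyc_reduced (k :: w) ->
  0 < twisted_len (of_word (k :: w)).
Proof.
move=> k0 /twisted_len_circuit ->; rewrite wlen_cons.
by apply: lt_le_trans k0 _; apply: oz_ler_wDr; apply: wlen_ge0.
Qed.

(* The circuits of [k :: u] and [k :: v] both start with the edge of [k], so at
   least twice its weight is lost in the quotient. *)
Lemma twisted_len_quotient k u v : 0 < wt (Some k.1) ->
  cyc_reduced (k :: u) -> cyc_reduced (k :: v) ->
  twisted_len (of_word u * (of_word v)^-1)%g <
    twisted_len (of_word (k :: u)) + twisted_len (of_word (k :: v)).
Proof.
move=> k0 ru rv; rewrite !twisted_len_circuit //.
rewrite -(plen_A1 pseudo_length_twisted (of_letter k)).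
have -> : (of_letter k * (of_word u * (of_word v)^-1) * (of_letter k)^-1 =
    of_word (k :: u) * (of_word (k :: v))^-1)%g by rewrite /= invgM !mulgA.
have twistV g : twist g^-1%g = (twist g)^-1%g.
  have twist1 : twist 1%g = 1%g by [].
  by apply: (mulgI (twist g)); rewrite -twistM !mulgV.
rewrite /twisted_len /comp twistM twistV.
rewrite !(twist_circuit _ _ k); set z := of_word (approach k).
have -> (e g h : free_group (option X)) :
    (z * (e * g) * z^-1 * (z * (e * h) * z^-1)^-1 =
     z * e * (g * h^-1) * (z * e)^-1)%g.
  by rewrite !invgM invgK !mulgA mulgVK.
rewrite cyc_lenJ // -of_wordV -of_word_cat.
apply: le_lt_trans (cyc_len_le _ _) _ => //.
rewrite wlen_cat wlenV !wlen_cons.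
by apply: oz_ltD; rewrite -{1}[wlen _ _]add0r ![_ + wlen _ _]addrC oz_ltD2lE.
Qed.

End TwistedLength.

(** * Uniqueness by comparison of two pseudo-lengths *)

Section Uniqueness.

Variables (L : orderedZmodType) (p q : F_ab -> L).
Implicit Types (k l m : bool * bool) (u v w : seq (bool * bool)).
Hypotheses (pP : pseudo_length p) (qP : pseudo_length q).
Hypothesis q_gt0 : forall k w,
  cyc_reduced (k :: w) -> 0 < q (of_word (k :: w)).
Hypothesis q_quotient : forall k u v,
  cyc_reduced (k :: u) -> cyc_reduced (k :: v) ->
  q (of_word u * (of_word v)^-1)%g <
    q (of_word (k :: u)) + q (of_word (k :: v)).
Hypotheses (pq_a : p F_a = q F_a) (pq_b : p F_b = q F_b).
Hypotheses (pq_ab : p (F_a * F_b)%g = q (F_a * F_b)%g).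
Hypotheses (pq_aV : p (F_a * F_b^-1)%g = q (F_a * F_b^-1)%g).

Let letterE (x s : bool) :
  of_letter (x, s) = (if s then (free_gen x)^-1 else free_gen x)%g.
Proof. by case: s; apply: val_inj. Qed.

Lemma plen_letter k : p (of_letter k) = q (of_letter k).
Proof.
by case: k => [] [] []; rewrite letterE ?(plenV pP) ?(plenV qP).
Qed.

(** Swapping the factors and inverting the product reduce every choice of signs to [ab] or
    [ab^-1]. *)
Lemma plen_letter2 k l : l.1 != k.1 ->
  p (of_letter k * of_letter l)%g = q (of_letter k * of_letter l)%g.
Proof.
wlog k1 : k l / k.1.
  move=> wl kl; case k1 : k.1; first exact: wl.
  rewrite (plenC pP) (plenC qP) wl 1?eq_sym //.
  by move: kl; rewrite k1; case: l.1.
case: k l k1 => [] [] s [] [] t // _ _; rewrite !letterE.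
rewrite -/F_a -/F_b; case: s; case: t => //.
- by rewrite -invgM (plenV pP) (plenV qP) (plenC pP) (plenC qP).
- rewrite -(plenV pP) -(plenV qP) invgM invgK.
  by rewrite (plenC pP) (plenC qP).
Qed.

(** The quotient of [ku] by [kv] is conjugate to [u v^-1], hence shorter than the sum of their
    lengths, for [p] as well as for [q]; then [plen_sum] applies. *)
Lemma plen_repeat k u v : cyc_reduced (k :: u) -> cyc_reduced (k :: v) ->
  p (of_word (k :: u)) = q (of_word (k :: u)) ->
  p (of_word (k :: v)) = q (of_word (k :: v)) ->
  p (of_word u * (of_word v)^-1)%g = q (of_word u * (of_word v)^-1)%g ->
  let s := q (of_word (k :: u)) + q (of_word (k :: v)) in
  p (of_word ((k :: u) ++ k :: v)) = s /\ q (of_word ((k :: u) ++ k :: v)) = s.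
Proof.
move=> ru rv eu ev euv.
have quotE (r : F_ab -> L) : pseudo_length r ->
    r (of_word (k :: u) * (of_word (k :: v))^-1)%g =
    r (of_word u * (of_word v)^-1)%g.
  move=> rP; rewrite -(plen_A1 rP (of_letter k) (of_word u * _)%g) /=.
  by rewrite invgM !mulgA.
have u0 := q_gt0 ru; have v0 := q_gt0 rv; have lt := q_quotient ru rv.
rewrite of_word_cat; split; last by apply: plen_sum => //; rewrite quotE.
by rewrite -eu -ev; apply: plen_sum; rewrite ?eu ?ev // quotE // euv.
Qed.

(* [p] is compared on the commutator and on k l k l^-1, which repeats k: the
   two values agree because the latter exceeds p(k) + p(l k l^-1). *)
Lemma plen_commutator k l : l.1 != k.1 ->
  p (of_letter k * of_letter l * (of_letter k)^-1 * (of_letter l)^-1)%g =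
  q (of_letter k * of_letter l * (of_letter k)^-1 * (of_letter l)^-1)%g.
Proof.
move=> kl; pose l' := letter_inv l.
pose K := of_letter k; pose M := of_letter l.
have kl' : l'.1 != k.1 by [].
have lk : k.1 != l.1 by rewrite eq_sym.
have rkl := cyc_reduced_letter2 kl; have rkl' := cyc_reduced_letter2 kl'.
have rk : @cyc_reduced bool [:: k] by rewrite /cyc_reduced /= letter_inv_neq.
have rl : @cyc_reduced bool [:: l] by rewrite /cyc_reduced /= letter_inv_neq.
have k0 := q_gt0 rk; have l0 := q_gt0 rl; rewrite !of_word1 in k0 l0.
have sqrE (r : F_ab -> L) : pseudo_length r -> 0 < r M ->
    r (M * M)%g = r M *+ 2.
  by move=> rP r0; apply: plen_sqr.
have e2 m : m.1 != k.1 -> p (of_word [:: k; m]) = q (of_word [:: k; m]).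
  by move=> km; rewrite /= !mulg1; apply: plen_letter2.
have := plen_repeat rkl rkl' (e2 _ kl) (e2 _ kl').
rewrite !of_word1 of_letterV invgK -/M.
rewrite (sqrE p pP) ?plen_letter // (sqrE q qP) // => /(_ erefl) [pe qe].
(* The roles of [k] and [l] are exchanged: the words [lk] and [lk^-1] share [l], and their
   remainders have quotient [K * K]. *)
have lt : q K *+ 2 < q (of_word [:: k; l]) + q (of_word [:: k; l']).
  have := q_quotient (cyc_reduced_letter2 lk)
    (@cyc_reduced_letter2 _ l (letter_inv k) lk).
  rewrite !of_word1 of_letterV invgK (plen_sqr qP) // /= !mulg1 !of_letterV.
  rewrite (plenC qP (of_letter l)) -(plenV qP (of_letter l * _)%g) invgM invgK.
  by rewrite -/M.
move: pe qe lt; set s := q _ + q _ => pe qe lt.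
have main (r : F_ab -> L) : pseudo_length r -> r K = q K ->
    r (of_word ([:: k; l] ++ [:: k; l'])) = s -> r (K * M * K^-1 * M^-1)%g = s.
  move=> rP rK; rewrite /= mulg1 of_letterV -/K -/M !mulgA => rE.
  have -> : (K * M * K^-1 * M^-1 = K * (M * K * M^-1)^-1)%g.
    by rewrite !invgM invgK !mulgA.
  have := plen_eq rP (g := K) (h := (M * K * M^-1)^-1%g).
  by rewrite (plenV rP) (plen_A1 rP) invgK rK !mulgA rE -mulr2n; apply.
by rewrite (main p) ?plen_letter // (main q).
Qed.

(** Neighbours, being neither equal nor inverse, involve different generators. So the generators
    alternate, letters two places apart are inverse, and four letters are all there are. *)
Lemma uniq_cyc_reduced w : cyc_reduced w -> uniq w ->
  [\/ w = [::], exists k, w = [:: k],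
      exists k l, l.1 != k.1 /\ w = [:: k; l]
    | exists k l, l.1 != k.1 /\ w = [:: k; l; letter_inv k; letter_inv l]].
Proof.
have next k l : l != letter_inv k -> k != l -> l.1 != k.1.
  by case: k l => [[] []] [[] []].
have opp k l m : l.1 != k.1 -> m.1 != l.1 -> k != m -> m = letter_inv k.
  by case: k l m => [[] []] [[] []] [[] []].
case: w => [|k [|l [|m [|n [|o w]]]]] rw uw; first by constructor 1.
- by constructor 2; exists k.
- constructor 3; exists k, l; move: rw uw; rewrite /cyc_reduced /= inE andbT.
  by move=> /andP[lk _] /andP[kl _]; rewrite next.
- move: rw uw; rewrite /cyc_reduced /= !inE !negb_or !andbT.
  move=> /and3P[lk ml km] /andP[/andP[kl k_m] l_m].
  (* In a word of three letters the third would be inverse to the first, which follows it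
     cyclically. *)
  rewrite (opp k l m (next _ _ lk kl) (next _ _ ml l_m) k_m) in km.
  by rewrite letter_invK eqxx in km.
- move: rw uw; rewrite /cyc_reduced /= !inE !negb_or !andbT.
  move=> /and4P[lk ml nm kn] /and3P[/and3P[kl k_m k_n] /andP[lm l_n] mn].
  have {}lk := next _ _ lk kl; have {}ml := next _ _ ml lm.
  constructor 4; exists k, l; split=> //.
  by rewrite (opp _ _ _ ml (next _ _ nm mn) l_n) (opp _ _ _ lk ml k_m).
- have := card_uniqP uw; have := max_card (mem [:: k, l, m, n, o & w]).
  by rewrite card_prod card_bool => le4 e; rewrite e in le4.
Qed.

Lemma not_uniq (T : eqType) (s : seq T) : ~~ uniq s ->
  exists s1 x s2 s3, s = s1 ++ x :: s2 ++ x :: s3.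
Proof.
elim: s => //= x s IHs; rewrite negb_and negbK => /orP[|/IHs].
  by case/splitPr => s2 s3; exists [::], x, s2, s3.
by case=> s1 [y [s2 [s3 ->]]]; exists (x :: s1), y, s2, s3.
Qed.

(** The induction on size runs over all words, because the word for [u v^-1] need not be reduced. A
    word that is not cyclically reduced is shortened by a cancellation or a conjugation. *)
Lemma plen_words w : p (of_word w) = q (of_word w).
Proof.
have [n] := ubnP (size w); elim: n w => // n IHn w; rewrite ltnS => le_wn.
have [rw|] := boolP (cyc_reduced w); last first.
  case: w le_wn => // k w le_wn; rewrite cyc_reduced_cons negb_and => /orP[].
    move=> /not_reduced[u [l [v e]]]; rewrite e in le_wn *.
    have -> : of_word (u ++ [:: l, letter_inv l & v]) = of_word (u ++ v).
      by rewrite !of_word_cat /= of_letterV mulVKg.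
    apply: IHn; apply: leq_trans le_wn; rewrite !size_cat /=.
    by rewrite ltn_add2l ltnW.
  rewrite negbK; case/lastP: w le_wn => [|w l] le_wn.
    by rewrite (negPf (letter_inv_neq k)).
  rewrite last_rcons eq_letter_inv => /eqP ->.
  rewrite /= -cats1 of_word_cat of_word1 of_letterV mulgA.
  rewrite (plen_A1 pP) (plen_A1 qP).
  by apply: IHn; move: le_wn; rewrite /= size_rcons; apply: ltnW.
have [uw|nuw] := boolP (uniq w).
  case: (uniq_cyc_reduced rw uw) => [->|[k ->]|[k [l [kl ->]]]|[k [l [kl ->]]]].
  - by rewrite /= (plen1 pP) (plen1 qP).
  - by rewrite of_word1 plen_letter.
  - by rewrite /= mulg1 plen_letter2.
  - by rewrite /= mulg1 !of_letterV !mulgA plen_commutator.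
(* Rotation brings a repeated letter to the front, which splits the word into [kv] and [kv'u], both
   shorter than [w]. *)
have [u [k [v [v' e]]]] := not_uniq nuw.
have rotE (r : F_ab -> L) : pseudo_length r ->
    r (of_word w) = r (of_word ((k :: v) ++ k :: v' ++ u)).
  move=> rP; rewrite e of_word_cat (plenC rP) -of_word_cat.
  by rewrite -[k :: v ++ _]cat_cons -catA.
have : cyc_reduced ((k :: v) ++ k :: v' ++ u).
  move: rw; rewrite /cyc_reduced -(rot_cycle (size u)) e rot_size_cat.
  by rewrite -[k :: v ++ _]cat_cons -catA.
rewrite cyc_reduced_cat => /and4P[rv rv' kv kv'].
have {rv kv}rv : cyc_reduced (k :: v) by rewrite cyc_reduced_cons rv.
have {rv' kv'}rv' : cyc_reduced (k :: v' ++ u) by rewrite cyc_reduced_cons rv'.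
rewrite (rotE p pP) (rotE q qP).
have le_n x : (x < size w -> x < n)%N.
  by move=> lt; apply: leq_trans lt le_wn.
have size_w : size w = (size u + (size v + (size v').+1).+1)%N.
  by rewrite e size_cat /= size_cat.
have lt1 i j r : (j.+1 < i + (j + r.+1).+1)%N by lia.
have lt2 i j r : ((r + i).+1 < i + (j + r.+1).+1)%N by lia.
have lt3 i j r : (j + (r + i) < i + (j + r.+1).+1)%N by lia.
have [|||-> -> //] := plen_repeat rv rv'.
- by apply/IHn/le_n; rewrite size_w; apply: lt1.
- by apply/IHn/le_n; rewrite size_w /= size_cat; apply: lt2.
- rewrite -of_wordV -of_word_cat; apply/IHn/le_n.
  by rewrite size_w size_cat size_word_inv size_cat; apply: lt3.
Qed.

End Uniqueness.

(** * Choice of the graph and of its weights *)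

Theorem theorem3p8 (L : orderedZmodType) (L_nontrivial : exists x : L, x != 0)
    (alpha beta gamma delta : L)
    (h1 : in_2L (gamma - alpha - beta) /\ in_2L (delta - alpha - beta))
    (h2 : (gamma = delta /\ alpha + beta < delta) \/
          Num.max gamma delta = alpha + beta)
    (h3 : [/\ 0 < alpha, 0 < beta &
              oz_abs (alpha - beta) < Num.min gamma delta]) :
  exists! l : F_ab -> L,
    pseudo_length l /\
    [/\ l F_a = alpha, l F_b = beta,
        l (F_a * F_b)%g = gamma & l (F_a * F_b^-1)%g = delta].
Proof.
suff [wt [far [[wa wb wt0] [ea eb eab eaV]]]] :
  exists (wt : option bool -> L) far,
    [/\ 0 < wt (Some true), 0 < wt (Some false) & 0 <= wt None] /\
    [/\ twisted_len wt far F_a = alpha, twisted_len wt far F_b = beta,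
        twisted_len wt far (F_a * F_b)%g = gamma
      & twisted_len wt far (F_a * F_b^-1)%g = delta].
  have wt_gt0 x : 0 < wt (Some x) by case: x.
  have wt_ge0 x : 0 <= wt x by case: x => [x|] //; apply: ltW.
  have qP := pseudo_length_twisted far wt_ge0.
  exists (twisted_len wt far); split=> // p [pP [pa pb pab paV]].
  apply: functional_extensionality => g; rewrite -[g]of_wordK; apply/esym.
  apply: (plen_words pP qP) => [k w rw|k u v ru rv||||].
  - exact: twisted_len_gt0.
  - exact: twisted_len_quotient.
  - by rewrite pa ea.
  - by rewrite pb eb.
  - by rewrite pab eab.
  - by rewrite paV eaV.
have ltmin (x : L) : oz_abs x < Num.min gamma delta ->
    [/\ x < gamma, - x < gamma, x < delta & - x < delta].
  rewrite (comparable_lt_min _ (oz_comparable _ _)).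
  rewrite !(comparable_gt_max _ (oz_comparable _ _)).
  by case/andP=> /andP[-> ->] /andP[].
case: h3 => a0 b0 /ltmin[] {ltmin}; rewrite opprB => abg bag abd bad.
case: h1 => [[u eu] [v ev]].
have eg : gamma = alpha + beta + u *+ 2.
  by rewrite -eu -[gamma - _ - _]addrA -opprD subrKC.
have ed : delta = alpha + beta + v *+ 2.
  by rewrite -ev -[delta - _ - _]addrA -opprD subrKC.
pose wt wa wb ws (x : option bool) : L :=
  if x is Some y then if y then wa else wb else ws.
(* Here [z - (y - x)] is the double of [x + e]. This makes the private part of a circle positive
   once the shared segment is removed. *)
have half (x y e z : L) : z = x + y + e *+ 2 -> y - x < z -> 0 < x + e.
  move=> ->; rewrite -oz_mul2n_gt0 -oz_subr_gt0 opprB addrC.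
  by rewrite [x + y]addrC !addrA subrK mulrnDl !mulr2n !addrA.
have values wa wb ws far : let l := twisted_len (wt wa wb ws) far in
    [/\ l F_a = wa + ws *+ (far (true, true) != far (true, false)),
        l F_b = wb + ws *+ (far (false, true) != far (false, false)),
        l (F_a * F_b)%g = wa + wb + ws *+
          ((far (true, true) != far (false, false))
          + (far (false, true) != far (true, false)))
      & l (F_a * F_b^-1)%g = wa + wb + ws *+
          ((far (true, true) != far (false, true))
          + (far (false, false) != far (true, false)))].
  rewrite /=; split.
  - exact: twisted_len_letter.
  - exact: twisted_len_letter.
  - exact: (@twisted_len_letter2 _ _ _ _ (true, false) (false, false)).
  - exact: (@twisted_len_letter2 _ _ _ _ (true, false) (false, true)).
(* The vertices placed at the far end of [None] are, in the three cases: both ends of [b]; the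
   starts of [a] and [b]; the start of [a] and the end of [b]. *)
case: h2 => [[gd ltd]|/oz_max_eq[leg led [egab|edab]]].
- (* two circles joined by a segment of length v *)
  exists (wt alpha beta v), (fun k => ~~ k.1).
  case: (values alpha beta v (fun k => ~~ k.1))
    => /= -> -> -> ->; rewrite gd ed !addr0; split=> //; split=> //=.
  by apply: ltW; rewrite -oz_mul2n_gt0 -ev -addrA -opprD oz_subr_gt0.
- (* two circles sharing a segment of length -v, which a and b traverse in the
     same direction *)
  exists (wt (alpha + v) (beta + v) (- v)), (fun k => ~~ k.2).
  case: (values (alpha + v) (beta + v) (- v) (fun k => ~~ k.2))
    => /= -> -> -> ->.
  have v0 : 0 <= - v.
    by rewrite -oz_mul2n_ge0 mulNrn oz_oppr_ge0 -ev -addrA -opprD -oz_oppr_ge0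
      opprB oz_subr_ge0.
  split; split=> //.
  - exact: half ed bad.
  - by apply: half abd; rewrite ed [beta + _]addrC.
  - by rewrite addrK.
  - by rewrite addrK.
  - by rewrite egab addrACA !addrK.
  - by rewrite addr0 addrACA -mulr2n ed.
- (* the same with opposite directions *)
  exists (wt (alpha + u) (beta + u) (- u)), (fun k => k.1 (+) k.2).
  case: (values (alpha + u) (beta + u) (- u) (fun k => k.1 (+) k.2))
    => /= -> -> -> ->.
  have u0 : 0 <= - u.
    by rewrite -oz_mul2n_ge0 mulNrn oz_oppr_ge0 -eu -addrA -opprD -oz_oppr_ge0
      opprB oz_subr_ge0.
  split; split=> //.
  - exact: half eg bag.
  - by apply: half abg; rewrite eg [beta + _]addrC.
  - by rewrite addrK.
  - by rewrite addrK.
  - by rewrite addr0 addrACA -mulr2n eg.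
  - by rewrite edab addrACA !addrK.
Qed.
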